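(* Consider either the Fokker-Planck scheme with a discrete Maxwellian satisfying (A-FP), or the BGK scheme with a discrete Maxwellian satisfying (A-BGK) (all defined in the context), assume that the number $N$ of points of the space discretization is odd, and that the initial data satisfies $\sum_{(i,j)\in\mathcal I\times\mathcal J}\Delta x_i\Delta v_jf_{ij}^0=0$. Let $\Delta t_{\max}>0$. Then there is $\eta_2>0$ such that for all $0<\varepsilon\le1$, $0<\Delta t\le\Delta t_{\max}$ and $0<\eta\le\eta_2$, the solution of the scheme satisfies $$\frac{\mathbb H(f^{n+1})-\mathbb H(f^n)}{\Delta t}+K(\eta)\left(\|f^{n+1}-\rho^{n+1}\mathcal M\|_{2,\gamma}^2+\|\rho^{n+1}\|_2^2\right)\le0,\qquad\forall n\ge1,$$ with $K(\eta)=\frac12\min\left(1-\eta\,\overline m_2,\ \eta\,\underline m_2\right)$.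
   Context: Velocity mesh. Fix $v_\star>0$ and an integer $L\ge1$. Interfaces $v_{j+1/2}$, $j=-L,\dots,L$, are strictly increasing with $v_{-L+1/2}=-v_\star$, $v_{1/2}=0$, $v_{L+1/2}=v_\star$ and $v_{j+1/2}=-v_{-j+1/2}$ for $j=0,\dots,L$. Let $\mathcal J=\{-L+1,\dots,L\}$; for $j\in\mathcal J$ the cell $(v_{j-1/2},v_{j+1/2})$ has length $\Delta v_j$ and midpoint $v_j$. Let $\mathcal J^*=\{-L,\dots,L\}$, $v_{-L}:=-v_\star$, $v_{L+1}:=v_\star$ and $\Delta v_{j+1/2}=v_{j+1}-v_j$ for $j\in\mathcal J^*$. Space mesh. The torus of length $1$ is divided into $N$ consecutive intervals indexed by $\mathcal I=\mathbb Z/N\mathbb Z$, of lengths $\Delta x_i>0$ with $\sum_i\Delta x_i=1$. For $\phi\in\mathbb R^{\mathcal I}$: $\phi_{i+1/2}=\frac{\phi_i+\phi_{i+1}}2$ and $(D_x\phi)_i=\frac{\phi_{i+1/2}-\phi_{i-1/2}}{\Delta x_i}$. Discrete Maxwellians. Let $0<\underline m_2\le\overline m_2$ and $\overline m_4$ be fixed constants, and $m_k^{\Delta v}=\sum_{j\in\mathcal J}|v_j|^k\mathcal M_j\Delta v_j$. (A-BGK): $(\mathcal M_j)_{j\in\mathcal J}$ satisfies $\mathcal M_j>0$ for all $j\in\mathcal J$, $\mathcal M_j=\mathcal M_{-j+1}$ for $j=1,\dots,L$, $\sum_{j\in\mathcal J}\mathcal M_j\Delta v_j=1$, $\underline m_2\le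 m_2^{\Delta v}\le\overline m_2$, $m_4^{\Delta v}\le\overline m_4$. (A-FP): $(\mathcal M^*_{j+1/2})_{j\in\mathcal J^*}$ satisfies $\mathcal M^*_{j+1/2}=\mathcal M^*_{-j+1/2}$ for $j\in\mathcal J^*$, $\mathcal M^*_{L+1/2}=\mathcal M^*_{-L+1/2}=0$, $\mathcal M_j:=\frac{\mathcal M^*_{j-1/2}-\mathcal M^*_{j+1/2}}{v_j\Delta v_j}>0$ for $j\in\mathcal J$, $\sum_{j\in\mathcal J}\mathcal M_j\Delta v_j=1$, $\underline m_2\le m_2^{\Delta v}\le\overline m_2$, $m_4^{\Delta v}\le\overline m_4$. Schemes ($\varepsilon>0$, $\Delta t>0$). Transport flux: $\mathcal F^{n}_{i+1/2,j}=v_j\frac{f^n_{i+1,j}+f^n_{ij}}2\Delta v_j$. Fokker-Planck scheme: for all $i\in\mathcal I,j\in\mathcal J,n\ge0$, $$\varepsilon\Delta x_i\Delta v_j(f_{ij}^{n+1}-f_{ij}^n)+\Delta t(\mathcal F^{n+1}_{i+1/2,j}-\mathcal F^{n+1}_{i-1/2,j})=\frac{\Delta t}{\varepsilon}(\mathcal G^{n+1}_{i,j+1/2}-\mathcal G^{n+1}_{i,j-1/2}),$$ where $\mathcal G^{n}_{i,j+1/2}=\mathcal M^*_{j+1/2}\left(\frac{f^n_{i,j+1}}{\mathcal M_{j+1}}-\frac{f^n_{ij}}{\mathcal M_j}\right)\frac{\Delta x_i}{\Delta v_{j+1/2}}$ for $j\in\mathcal J^*\setminus\{-L,L\}$ and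 $\mathcal G^n_{i,-L+1/2}=\mathcal G^n_{i,L+1/2}=0$. BGK scheme: for all $i\in\mathcal I,j\in\mathcal J,n\ge0$, $$\varepsilon\Delta x_i\Delta v_j(f_{ij}^{n+1}-f_{ij}^n)+\Delta t(\mathcal F^{n+1}_{i+1/2,j}-\mathcal F^{n+1}_{i-1/2,j})=\frac{\Delta t}{\varepsilon}\Delta x_i\Delta v_j(\rho_i^{n+1}\mathcal M_j-f_{ij}^{n+1}).$$ Moments and norms. $\rho_i^n=\sum_{j\in\mathcal J}\Delta v_jf_{ij}^n$, $J_i^n=\frac1\varepsilon\sum_{j\in\mathcal J}\Delta v_jv_jf_{ij}^n$; $\rho^n\mathcal M$ has entries $\rho_i^n\mathcal M_j$; $\gamma_j=1/\mathcal M_j$; $\|g\|_{2,\gamma}^2=\sum_{(i,j)\in\mathcal I\times\mathcal J}|g_{ij}|^2\gamma_j\Delta x_i\Delta v_j$; $\|\rho\|_2^2=\sum_{i\in\mathcal I}|\rho_i|^2\Delta x_i$. Discrete Poisson equation. $\phi^n\in\mathbb R^{\mathcal I}$ is the unique solution of $-\frac{(D_x\phi^n)_{i+1}-(D_x\phi^n)_{i-1}}2=\Delta x_i\rho_i^n$ for all $i\in\mathcal I$, with $\sum_{i\in\mathcal I}\Delta x_i\phi_i^n=0$ (well defined since $N$ is odd and $\sum_i\Delta x_i\rho_i^n=0$). Discrete modified entropy. For $\eta>0$ and $n\ge1$, $$\mathbb H(f^n)=\frac12\|f^n\|_{2,\gamma}^2+\eta\varepsilon^2\sum_{i\in\mathcal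 I}\Delta x_iJ_i^n(D_x\phi^n)_i+\frac{\eta\varepsilon^2}2\sum_{i\in\mathcal I}\Delta x_i\frac{\left((D_x\phi^n)_i-(D_x\phi^{n-1})_i\right)^2}{\Delta t}.$$ *)

(* Defs.v *)
From mathcomp Require Import all_boot all_order all_algebra.
From mathcomp Require Import reals.

Set Implicit Arguments.
Unset Strict Implicit.
Unset Printing Implicit Defensive.

Import Order.TTheory GRing.Theory Num.Theory.
Local Open Scope ring_scope.

(* Velocity indices are integers j, and families indexed by velocities are
   functions on int, of which only the values on the relevant finite range
   matter: J = {-L+1, ..., L} for cells, J^* = {-L, ..., L} for interfaces.
   A family carried by interfaces stores its value at j+1/2 under index j,
   so the value at j-1/2 is found under index j-1. *)
Definition in_J (L : nat) (j : int) : bool := 1 - L%:Z <= j <= L%:Z.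
Definition in_Jstar (L : nat) (j : int) : bool := - L%:Z <= j <= L%:Z.

Definition sum_J (R : realType) (L : nat) (F : int -> R) : R :=
  \sum_(k < L.*2) F (1 - L%:Z + k%:Z).

Record velocity_mesh (R : realType) (vstar : R) (L : nat) := VelocityMesh {
  vface :> int -> R;
  vface_lt : forall j : int,
    - L%:Z <= j -> j < L%:Z -> vface j < vface (j + 1);
  vface_first : vface (- L%:Z) = - vstar;
  vface_mid : vface 0 = 0;
  vface_last : vface L%:Z = vstar;
  vface_sym : forall j : int, 0 <= j <= L%:Z -> vface j = - vface (- j) }.

(* The interval i : 'I_N stands for an element of Z/NZ: [ordS i] is i+1 and
   [ord_pred i] is i-1, both cyclic. *)
Record space_mesh (R : realType) (N : nat) := SpaceMesh {
  dx :> 'I_N -> R;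
  dx_gt0 : forall i, 0 < dx i;
  dx_sum : \sum_i dx i = 1 }.

Section Velocity.
Variables (R : realType) (vstar : R) (L : nat) (V : velocity_mesh vstar L).

Definition dv (j : int) : R := V j - V (j - 1).

(* Cell midpoints, extended by v_{-L} = -vstar and v_{L+1} = vstar. *)
Definition vmid (j : int) : R :=
  if j == - L%:Z then - vstar
  else if j == L%:Z + 1 then vstar
  else (V (j - 1) + V j) / 2.

Definition dvface (j : int) : R := vmid (j + 1) - vmid j.

Definition moment (k : nat) (M : int -> R) : R :=
  sum_J L (fun j => `|vmid j| ^+ k * M j * dv j).

Definition moment_bounds (m2lo m2hi m4hi : R) (M : int -> R) : Prop :=
  [/\ sum_J L (fun j => M j * dv j) = 1,
      m2lo <= moment 2 M, moment 2 M <= m2hi & moment 4 M <= m4hi].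

Definition A_BGK (m2lo m2hi m4hi : R) (M : int -> R) : Prop :=
  [/\ forall j, in_J L j -> 0 < M j,
      forall j, 1 <= j <= L%:Z -> M j = M (- j + 1)
    & moment_bounds m2lo m2hi m4hi M].

Definition maxwellian_of_star (Mstar : int -> R) (j : int) : R :=
  (Mstar (j - 1) - Mstar j) / (vmid j * dv j).

Definition A_FP (m2lo m2hi m4hi : R) (Mstar : int -> R) : Prop :=
  [/\ forall j, in_Jstar L j -> Mstar j = Mstar (- j),
      Mstar L%:Z = 0 /\ Mstar (- L%:Z) = 0,
      forall j, in_J L j -> 0 < maxwellian_of_star Mstar j
    & moment_bounds m2lo m2hi m4hi (maxwellian_of_star Mstar)].

End Velocity.

Section Space.
Variables (R : realType) (N : nat) (X : space_mesh R N).

Definition at_face (phi : 'I_N -> R) (i : 'I_N) : R :=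
  (phi i + phi (ordS i)) / 2.

Definition Dx (phi : 'I_N -> R) (i : 'I_N) : R :=
  (at_face phi i - at_face phi (ord_pred i)) / X i.

Definition poisson (rho phi : 'I_N -> R) : Prop :=
  (forall i, - ((Dx phi (ordS i) - Dx phi (ord_pred i)) / 2) = X i * rho i)
  /\ \sum_i X i * phi i = 0.

Definition sqnorm (rho : 'I_N -> R) : R := \sum_i `|rho i| ^+ 2 * X i.

End Space.

(* The choice of a scheme, with the data defining its discrete Maxwellian. *)
Inductive kinetic_model (R : realType) :=
  | FokkerPlanck (Mstar : int -> R)
  | BGK (M : int -> R).

Section Scheme.
Variables (R : realType) (vstar : R) (L : nat) (V : velocity_mesh vstar L).
Variables (N : nat) (X : space_mesh R N).

Definition maxwellian (m : kinetic_model R) : int -> R :=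
  match m with
  | FokkerPlanck Mstar => maxwellian_of_star V Mstar
  | BGK M => M
  end.

Definition admissible (m2lo m2hi m4hi : R) (m : kinetic_model R) : Prop :=
  match m with
  | FokkerPlanck Mstar => A_FP V m2lo m2hi m4hi Mstar
  | BGK M => A_BGK V m2lo m2hi m4hi M
  end.

Definition density (g : 'I_N -> int -> R) (i : 'I_N) : R :=
  sum_J L (fun j => dv V j * g i j).

Definition flux (eps : R) (g : 'I_N -> int -> R) (i : 'I_N) : R :=
  eps^-1 * sum_J L (fun j => dv V j * vmid V j * g i j).

(* F_{i+1/2,j} and G_{i,j+1/2}, stored under (i,j). *)
Definition transport_flux (g : 'I_N -> int -> R) (i : 'I_N) (j : int) : R :=
  vmid V j * ((g (ordS i) j + g i j) / 2) * dv V j.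

Definition FP_flux (Mstar : int -> R) (g : 'I_N -> int -> R)
    (i : 'I_N) (j : int) : R :=
  let M := maxwellian_of_star V Mstar in
  if (j == - L%:Z) || (j == L%:Z) then 0
  else Mstar j * (g i (j + 1) / M (j + 1) - g i j / M j) * (X i / dvface V j).

Definition collision (m : kinetic_model R) (g : 'I_N -> int -> R)
    (i : 'I_N) (j : int) : R :=
  match m with
  | FokkerPlanck Mstar => FP_flux Mstar g i j - FP_flux Mstar g i (j - 1)
  | BGK M => X i * dv V j * (density g i * M j - g i j)
  end.

Definition scheme (m : kinetic_model R) (eps dt : R)
    (f : nat -> 'I_N -> int -> R) : Prop :=
  forall (n : nat) (i : 'I_N) (j : int), in_J L j ->
    eps * X i * dv V j * (f n.+1 i j - f n i j)
    + dt * (transport_flux (f n.+1) i j - transport_flux (f n.+1) (ord_pred i) j)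
    = dt / eps * collision m (f n.+1) i j.

Definition sqnorm_gamma (M : int -> R) (g : 'I_N -> int -> R) : R :=
  \sum_i sum_J L (fun j => `|g i j| ^+ 2 * (M j)^-1 * X i * dv V j).

(* Meaningful for n >= 1 only, since it involves phi^{n-1}. *)
Definition entropy (M : int -> R) (eps dt eta : R)
    (f : nat -> 'I_N -> int -> R) (phi : nat -> 'I_N -> R) (n : nat) : R :=
  2^-1 * sqnorm_gamma M (f n)
  + eta * eps ^+ 2 * (\sum_i X i * flux eps (f n) i * Dx X (phi n) i)
  + eta * eps ^+ 2 / 2 *
      (\sum_i X i * ((Dx X (phi n) i - Dx X (phi n.-1) i) ^+ 2 / dt)).

End Scheme.

(* Main.v *)
(* Write [J] for the flux, [Phi = D_x phi] for the field and [g = f - rho M].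
   Testing the scheme with [f / M] makes the transport term vanish and yields the
   dissipation [|g|^2 / eps^2]; for Fokker-Planck this is a discrete Gaussian
   Poincare inequality of constant 1, valid because the cell midpoints form a
   monotone eigenvector of the discrete operator.
   The moments of order 0 and 1 satisfy [(rho' - rho) / dt + D_x J' = 0] and
   [eps^2 (J' - J) / dt + D_x S' = - J'], with [S = m_2 rho + O(|g|)].
   By duality with the Poisson equation [<D_x S', Phi'> = <S', rho'>], which
   provides the missing dissipation [m_2 |rho'|^2], while the mass equation gives
   [(Phi' - Phi) / dt = J' - mean J'] because [N] is odd; hence the time
   increment of the corrector costs at most [eps^2 |J'|^2 <= m_2 |g|^2].
   The other cross terms are absorbed by Young's inequality for small [eta]. *)

Require Import Defs.
From mathcomp Require Import all_boot all_order all_algebra.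
From mathcomp Require Import reals.
From mathcomp Require Import ring lra zify.

Set Implicit Arguments.
Unset Strict Implicit.
Unset Printing Implicit Defensive.

Import Order.TTheory GRing.Theory Num.Theory.
Local Open Scope ring_scope.

(** * Discrete Poincare inequality and odd cycles *)

(** Lagrange's identity: twice the defect is the double sum of the squares
    [(a i * b j - b i * a j) ^+ 2] with weights [w i * w j]. *)
Lemma cauchy_schwarz_sum (R : realFieldType) (I : finType) (w a b : I -> R) :
  (forall i, 0 <= w i) ->
  (\sum_i w i * (a i * b i)) ^+ 2
    <= (\sum_i w i * a i ^+ 2) * (\sum_i w i * b i ^+ 2).
Proof.
move=> w0.
set A := \sum_i w i * a i ^+ 2; set B := \sum_i w i * (a i * b i).
set C := \sum_i w i * b i ^+ 2.
suff H : 0 <= A * C - B * B - B * B + C * A.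
  by rewrite expr2; lra.
have -> : A * C - B * B - B * B + C * A
    = \sum_i \sum_j w i * w j * (a i * b j - b i * a j) ^+ 2.
  rewrite !big_distrlr /= -!sumrB -big_split; apply: eq_bigr => i _ /=.
  by rewrite -!sumrB -big_split; apply: eq_bigr => j _ /=; ring.
by apply: sumr_ge0 => i _; apply: sumr_ge0 => j _;
  exact: mulr_ge0 (mulr_ge0 (w0 i) (w0 j)) (sqr_ge0 _).
Qed.

(** Here [s] lives on interfaces and [c] on the cells between them; in every use below [s] vanishes
    at both ends. *)
Lemma sum_by_parts (R : comRingType) (n : nat) (s c : nat -> R) :
  \sum_(k < n.+1) (s k - s k.+1) * c k
    = s 0%N * c 0%N - s n.+1 * c n + \sum_(k < n) s k.+1 * (c k.+1 - c k).
Proof.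
elim: n => [|n IH]; first by rewrite big_ord_recr !big_ord0 /=; ring.
by rewrite big_ord_recr IH /= [in RHS]big_ord_recr /=; ring.
Qed.

Section DiscretePoincare.
Variables (R : realFieldType) (n : nat) (x h : nat -> R).
Hypothesis x_lt : forall k, (k < n)%N -> x k < x k.+1.

(** Discrete primitive of the squared slope of [h] with respect to [x]. *)
Let energy k := \sum_(l < k) (h l.+1 - h l) ^+ 2 / (x l.+1 - x l).

(** Cauchy-Schwarz for the slope of [h] between two nodes; as [j <= k], both factors on the right
    are non-positive. *)
Lemma sqr_increment_le j k : (j <= k <= n)%N ->
  (h j - h k) ^+ 2 <= (x j - x k) * (energy j - energy k).
Proof.
case/andP=> jk kn.
(* The signs of both factors are carried through the induction because its AM-GM step relies on
   them. *)
suff : [/\ (h k - h j) ^+ 2 <= (x k - x j) * (energy k - energy j),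
           0 <= x k - x j & 0 <= energy k - energy j] by case=> H _ _; nra.
elim: k jk kn => [|k IH].
  by rewrite leqn0 => /eqP-> _; rewrite !subrr; split; lra.
rewrite leq_eqVlt => /orP[/eqP<- _|]; first by rewrite !subrr; split; lra.
rewrite ltnS => jk kn; have [H x0 e0] := IH jk (ltnW kn).
have d0 := x_lt kn; have D0 : 0 < x k.+1 - x k by rewrite subr_gt0.
have -> : energy k.+1 = energy k + (h k.+1 - h k) ^+ 2 / (x k.+1 - x k).
  by rewrite /energy big_ord_recr.
set e := _ / _; have e_ge0 : 0 <= e by rewrite divr_ge0 ?sqr_ge0 ?ltW.
have eE : e * (x k.+1 - x k) = (h k.+1 - h k) ^+ 2 by rewrite divfK ?gt_eqF.
split; [|lra|lra].
(* AM-GM: the cross term satisfies [(2 A d)^2 <= 4 (X e) (D Y) <= (X e + D Y)^2]. *)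
have -> : h k.+1 - h j = (h k - h j) + (h k.+1 - h k) by ring.
have -> : x k.+1 - x j = (x k - x j) + (x k.+1 - x k) by ring.
have -> : energy k + e - energy j = (energy k - energy j) + e by ring.
move: H x0 e0 D0 eE e_ge0; clearbody e.
move: (h k - h j) (h k.+1 - h k) (x k - x j) (x k.+1 - x k) (energy k - energy j).
move=> A d X D Y AXY X0 Y0 D0 eE e0.
suff H : 2 * (A * d) <= X * e + D * Y by nra.
have S0 : 0 <= X * e + D * Y by nra.
case: (lerP (A * d) 0) => [|Ad]; first by lra.
rewrite -(@ler_pXn2r _ 2) ?nnegrE //; last exact: mulr_ge0 (ler0n _ _) (ltW Ad).
have : A ^+ 2 * d ^+ 2 <= X * Y * (e * D).
  by rewrite -eE ler_wpM2r ?mulr_ge0 ?(ltW D0).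
by have := sqr_ge0 (X * e - D * Y); nra.
Qed.

(* The relation between [s] and [w] says that [x] is an eigenvector, for the
   eigenvalue 1, of the operator of this Dirichlet form; [x] being monotone,
   this eigenvalue is the spectral gap. *)
Lemma discrete_poincare (w s : nat -> R) :
  (forall k, (k <= n)%N -> 0 <= w k) -> \sum_(k < n.+1) w k = 1 ->
  s 0%N = 0 -> s n.+1 = 0 ->
  (forall k, (k <= n)%N -> s k - s k.+1 = w k * x k) ->
  \sum_(k < n.+1) w k * (h k - \sum_(l < n.+1) w l * h l) ^+ 2
    <= \sum_(k < n) s k.+1 * ((h k.+1 - h k) ^+ 2 / (x k.+1 - x k)).
Proof.
move=> w0 w1 s0 sn sE.
have wx0 : \sum_(k < n.+1) w k * x k = 0.
  transitivity (\sum_(k < n.+1) (s k - s k.+1) * 1).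
    by apply: eq_bigr => k _; rewrite sE ?mulr1 // -ltnS.
  rewrite (sum_by_parts n s (fun=> 1)) s0 sn !mul0r subrr add0r big1 // => k _.
  by rewrite subrr mulr0.
(* Each summand is [s] times an increment of [energy], so summation by parts yields the
   [w]-covariance of [x] and [energy], [x] having mean zero. *)
have -> : \sum_(k < n) s k.+1 * ((h k.+1 - h k) ^+ 2 / (x k.+1 - x k))
    = \sum_(k < n.+1) w k * (x k * energy k).
  transitivity (\sum_(k < n) s k.+1 * (energy k.+1 - energy k)).
    apply: eq_bigr => k _; rewrite /energy big_ord_recr /=.
    by rewrite [X in _ = _ * X]addrAC subrr add0r.
  have := sum_by_parts n s energy; rewrite s0 sn !mul0r subrr add0r => <-.
  by apply: eq_bigr => k _; rewrite sE ?mulrA // -ltnS.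
(* A covariance is half a double sum over pairs of nodes. Used for [(h, h)] and [(x, energy)], this
   reduces the claim to the pairwise bound [sqr_increment_le]. *)
have pairs (a b : nat -> R) :
    \sum_(j < n.+1) \sum_(k < n.+1) w j * w k * ((a j - a k) * (b j - b k))
    = 2 * (\sum_(k < n.+1) w k * (a k * b k) -
         (\sum_(k < n.+1) w k * a k) * \sum_(k < n.+1) w k * b k).
  set AB := \sum_(k < n.+1) w k * (a k * b k).
  set A := \sum_(k < n.+1) w k * a k; set B := \sum_(k < n.+1) w k * b k.
  have -> : 2 * (AB - A * B) = AB * \sum_(k < n.+1) w k
      + (\sum_(k < n.+1) w k) * AB - A * B - B * A by rewrite w1; ring.
  rewrite !big_distrlr /= -big_split -!sumrB; apply: eq_bigr => j _ /=.
  by rewrite -big_split -!sumrB; apply: eq_bigr => k _ /=; ring.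
set r := \sum_(l < n.+1) w l * h l.
have -> : \sum_(k < n.+1) w k * (h k - r) ^+ 2
    = \sum_(k < n.+1) w k * (h k * h k) - r * r.
  have -> : \sum_(k < n.+1) w k * (h k * h k) - r * r
     = \sum_(k < n.+1) w k * (h k * h k) - \sum_(k < n.+1) 2 * r * (w k * h k)
       + \sum_(k < n.+1) r ^+ 2 * w k.
    by rewrite -!mulr_sumr w1 -/r; ring.
  by rewrite -sumrB -big_split; apply: eq_bigr => k _ /=; ring.
rewrite -(@ler_pM2l _ 2) // -(pairs h h).
have -> : 2 * \sum_(k < n.+1) w k * (x k * energy k)
    = 2 * (\sum_(k < n.+1) w k * (x k * energy k)
       - (\sum_(k < n.+1) w k * x k) * \sum_(k < n.+1) w k * energy k).
  by rewrite wx0 mul0r subr0.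
rewrite -(pairs x energy); apply: ler_sum => j _; apply: ler_sum => k _.
apply: ler_wpM2l; first by rewrite mulr_ge0 ?w0 // -ltnS.
have le_n (i : 'I_n.+1) : (i <= n)%N by rewrite -ltnS.
case/orP: (leq_total j k) => jk; first by apply: sqr_increment_le; rewrite jk le_n.
have /sqr_increment_le : (k <= j <= n)%N by rewrite jk le_n.
by rewrite -expr2; nra.
Qed.

End DiscretePoincare.

Section OddCycle.
Variables (R : realFieldType) (N : nat).

Lemma sum_ordS (F : 'I_N -> R) : \sum_i F (ordS i) = \sum_i F i.
Proof. by rewrite [RHS](reindex_inj (@ordS_inj N)). Qed.

Lemma sum_ord_pred (F : 'I_N -> R) : \sum_i F (ord_pred i) = \sum_i F i.
Proof. by rewrite [RHS](reindex_inj (@ord_pred_inj N)). Qed.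

Let step2 (i : 'I_N) := ordS (ordS i).

Lemma iter_step2 m i : iter m step2 i = ((i + m.*2) %% N)%N :> nat.
Proof.
elim: m => [|m IH]; first by rewrite addn0 modn_small.
have modS a : ((a %% N).+1 %% N = a.+1 %% N)%N by rewrite -addn1 modnDml addn1.
by rewrite /= IH (modS (i + m.*2)%N) modS doubleS !addnS.
Qed.

(* As [N] is odd, the walk by steps of 2 visits each point exactly once. *)
Lemma odd_cycle_oscillation (F : 'I_N -> R) (i k : 'I_N) : odd N ->
  `|F i - F k| <= \sum_l `|F (ordS l) - F (ord_pred l)|.
Proof.
(* [visit m] is the point jumped over by step [m] of the walk, so the summand of the oscillation at
   [visit m] is the jump of [F] during that step. *)
move=> oddN; pose visit (m : 'I_N) := ordS (iter m step2 i).
(* A coincidence means that [N] divides [2 * (a - b)], hence [a - b] since [N] is odd, while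
   [a - b < N]. *)
have visit_inj : injective visit.
  move=> a b /(@ordS_inj N)/(congr1 (@nat_of_ord N)); rewrite !iter_step2.
  move/eqP; rewrite eqn_modDl -!muln2 => /eqP H; apply/val_inj => /=.
  have cop : coprime N 2 by rewrite coprime_sym coprime2n.
  wlog ba : a b H / (b <= a)%N => [W|].
    by case/orP: (leq_total b a) => ab; [|apply/esym]; apply: W.
  move/eqP: H; rewrite eqn_mod_dvd ?leq_mul2r // -mulnBl Gauss_dvdl //.
  have := ltn_ord a; case: (posnP (a - b)) => [ab0 _ _|ab0 aN /(dvdn_leq ab0)]; lia.
rewrite (reindex_inj visit_inj) /=.
(* An injection of a finite set into itself is onto, so the walk started at [i] reaches [k]. *)
have [m mN ->] : exists2 m, (m <= N)%N & k = iter m step2 i.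
  have [g vg gv] := injF_bij visit_inj; exists (g (ordS k)); first exact/ltnW.
  by apply: (@ordS_inj N); rewrite -/(visit _) gv.
have : `|F i - F (iter m step2 i)|
    <= \sum_(l < m) `|F (step2 (iter l step2 i)) - F (iter l step2 i)|.
  elim: m {mN} => [|m IH]; first by rewrite big_ord0 subrr normr0.
  rewrite big_ord_recr /=; apply: le_trans (lerD IH (lexx _)).
  by rewrite [X in _ <= _ + X]distrC; apply: ler_distD.
move/le_trans; apply.
(* The [m] steps actually walked are among all [N] steps, and the extra terms are non-negative. *)
rewrite (big_ord_widen _
  (fun l => `|F (step2 (iter l step2 i)) - F (iter l step2 i)|) mN).
rewrite big_mkcond; apply: ler_sum => l _.
by rewrite /visit ordSK; case: ifP.
Qed.

End OddCycle.

(** * Velocity sums and collision operators *)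

Section VelocitySums.
Variables (R : realType) (L : nat).
Implicit Types F G : int -> R.

Lemma in_J_ord (k : nat) : (k < L.*2)%N -> in_J L (1 - L%:Z + k%:Z).
Proof. rewrite /in_J; lia. Qed.

Lemma eq_sum_J F G : (forall j, in_J L j -> F j = G j) -> sum_J L F = sum_J L G.
Proof. by move=> FG; apply: eq_bigr => k _; rewrite FG ?in_J_ord. Qed.

Lemma ler_sum_J F G : (forall j, in_J L j -> F j <= G j) -> sum_J L F <= sum_J L G.
Proof. by move=> FG; apply: ler_sum => k _; rewrite FG ?in_J_ord. Qed.

Lemma sum_JD F G : sum_J L (fun j => F j + G j) = sum_J L F + sum_J L G.
Proof. exact: big_split. Qed.

Lemma sum_JB F G : sum_J L (fun j => F j - G j) = sum_J L F - sum_J L G.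
Proof. exact: sumrB. Qed.

Lemma sum_JZ a F : sum_J L (fun j => a * F j) = a * sum_J L F.
Proof. by rewrite /sum_J mulr_sumr. Qed.

Lemma sum_JN F : sum_J L (fun j => - F j) = - sum_J L F.
Proof. exact: sumrN. Qed.

Lemma sum_J_ge0 F : (forall j, in_J L j -> 0 <= F j) -> 0 <= sum_J L F.
Proof. by move=> F0; apply: sumr_ge0 => k _; rewrite F0 ?in_J_ord. Qed.

(** The reflection [j -> 1 - j] of the cells is the symmetry [v -> -v]; it reverses the enumeration
    of the velocities. *)
Lemma sum_J_odd F : (forall j, in_J L j -> F (1 - j) = - F j) -> sum_J L F = 0.
Proof.
move=> F_odd; suff : sum_J L F = - sum_J L F by lra.
rewrite {1}/sum_J (reindex_inj rev_ord_inj) -sumrN; apply: eq_bigr => k _.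
rewrite -F_odd ?in_J_ord //; congr F.
by have := ltn_ord k; rewrite /=; lia.
Qed.

Lemma sum_J_by_parts (s c : int -> R) :
  s (- L%:Z) = 0 -> s L%:Z = 0 ->
  sum_J L (fun j => (s (j - 1) - s j) * c j)
    = \sum_(k < L.*2.-1) s (1 - L%:Z + k%:Z) *
        (c (1 - L%:Z + k%:Z + 1) - c (1 - L%:Z + k%:Z)).
Proof.
(* For [L = 0] the truncated predecessor makes both sums empty; otherwise there are [L.*2.-1]
   interior interfaces. *)
move=> sl sr; have [L0|Lpos] := posnP L.
  by rewrite /sum_J L0 !big_ord0.
have [n Ln] : exists n, L.*2 = n.+1 by exists L.*2.-1; lia.
rewrite /sum_J Ln /=.
have := sum_by_parts n (fun k => s (k%:Z - L%:Z)) (fun k => c (1 - L%:Z + k%:Z)).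
have -> : n.+1%:Z - L%:Z = L by lia.
rewrite sub0r sl sr !mul0r subrr add0r => E.
transitivity (\sum_(k < n.+1)
    (s (k%:Z - L%:Z) - s (k.+1%:Z - L%:Z)) * c (1 - L%:Z + k%:Z)).
  apply: eq_bigr => k _.
  have -> : 1 - L%:Z + k%:Z - 1 = k%:Z - L%:Z by lia.
  by have -> : k.+1%:Z - L%:Z = 1 - L%:Z + k%:Z by lia.
rewrite E; apply: eq_bigr => k _.
have -> : k.+1%:Z - L%:Z = 1 - L%:Z + k%:Z by lia.
by have -> : 1 - L%:Z + k%:Z + 1 = 1 - L%:Z + k.+1%:Z by lia.
Qed.

Lemma cauchy_schwarz_sum_J (w a b : int -> R) :
  (forall j, in_J L j -> 0 <= w j) ->
  sum_J L (fun j => w j * (a j * b j)) ^+ 2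
    <= sum_J L (fun j => w j * a j ^+ 2) * sum_J L (fun j => w j * b j ^+ 2).
Proof. by move=> w0; apply: cauchy_schwarz_sum => k; rewrite w0 ?in_J_ord. Qed.

End VelocitySums.

Section VelocityMesh.
Variables (R : realType) (vstar : R) (L : nat) (V : velocity_mesh vstar L).

Lemma dv_gt0 j : in_J L j -> 0 < dv V j.
Proof.
rewrite /in_J => jJ; rewrite /dv subr_gt0.
have -> : V j = V (j - 1 + 1) by congr (V _); lia.
by apply: vface_lt; lia.
Qed.

Lemma vmid_in_J j : in_J L j -> vmid V j = (V (j - 1) + V j) / 2.
Proof.
rewrite /in_J => jJ; rewrite /vmid.
have -> : (j == - L%:Z) = false by apply/eqP; lia.
by have -> : (j == L%:Z + 1) = false by apply/eqP; lia.
Qed.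

Lemma vmid_lt j : in_J L j -> in_J L (j + 1) -> vmid V j < vmid V (j + 1).
Proof.
move=> j0 j1; have := dv_gt0 j0; have := dv_gt0 j1.
by rewrite !vmid_in_J // /dv addrK; lra.
Qed.

Lemma vface_odd j : in_Jstar L j -> V (- j) = - V j.
Proof.
rewrite /in_Jstar => jJ; have [j0|j0] := lerP 0 j.
  by rewrite (@vface_sym _ _ _ V j) ?opprK //; lia.
by rewrite (@vface_sym _ _ _ V (- j)) ?opprK //; lia.
Qed.

Lemma vmid_odd j : in_J L j -> vmid V (1 - j) = - vmid V j.
Proof.
move=> jJ; have jJ' : in_J L (1 - j) by move: jJ; rewrite /in_J; lia.
have [h0 h1] : in_Jstar L j /\ in_Jstar L (j - 1).
  by move: jJ; rewrite /in_J /in_Jstar; lia.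
rewrite !vmid_in_J // -(opprB j 1) vface_odd //.
have -> : - (j - 1) - 1 = - j by lia.
by rewrite vface_odd //; lra.
Qed.

Lemma dv_even j : in_J L j -> dv V (1 - j) = dv V j.
Proof.
move=> jJ; have [h0 h1] : in_Jstar L j /\ in_Jstar L (j - 1).
  by move: jJ; rewrite /in_J /in_Jstar; lia.
rewrite /dv -(opprB j 1) vface_odd //.
have -> : - (j - 1) - 1 = - j by lia.
by rewrite vface_odd // opprK addrC.
Qed.

End VelocityMesh.

Section Maxwellian.
Variables (R : realType) (vstar : R) (L : nat) (V : velocity_mesh vstar L).
Variables (m2lo m2hi m4hi : R) (m : kinetic_model R).
Hypothesis m_adm : admissible V m2lo m2hi m4hi m.

Let M := maxwellian V m.

Lemma maxwellian_gt0 j : in_J L j -> 0 < M j.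
Proof. by rewrite /M; case: m m_adm => [Ms|M0] /= []; auto. Qed.

Lemma maxwellian_moments : moment_bounds V m2lo m2hi m4hi M.
Proof. by rewrite /M; case: m m_adm => [Ms|M0] /= []. Qed.

Lemma maxwellian_weight_gt0 j : in_J L j -> 0 < dv V j * M j.
Proof. by move=> jJ; rewrite mulr_gt0 ?dv_gt0 ?maxwellian_gt0. Qed.

Lemma maxwellian_mass : sum_J L (fun j => dv V j * M j) = 1.
Proof.
by have [<- _ _ _] := maxwellian_moments; apply: eq_sum_J => j _; rewrite mulrC.
Qed.

End Maxwellian.

(** Discrete analogue of [M' = - v M]: it is the relation between [s] and [w] required by
    [discrete_poincare], with eigenvector [vmid]. *)
Lemma maxwellian_of_starE (R : realType) (vstar : R) (L : nat)
    (V : velocity_mesh vstar L) (Ms : int -> R) (j : int) :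
  0 < maxwellian_of_star V Ms j ->
  Ms (j - 1) - Ms j = dv V j * maxwellian_of_star V Ms j * vmid V j.
Proof.
rewrite /maxwellian_of_star => Mj.
(* Division by zero returns 0, so a positive quotient has a nonzero denominator. *)
have vd : vmid V j * dv V j != 0.
  by apply: contraTneq Mj => ->; rewrite invr0 mulr0 ltxx.
by rewrite mulrAC mulrC [dv V j * _]mulrC divfK.
Qed.

(** For Fokker-Planck the sum telescopes in [Ms], which vanishes at the extreme interfaces; for BGK
    the summand is odd in velocity. *)
Lemma maxwellian_mean (R : realType) (vstar : R) (L : nat)
    (V : velocity_mesh vstar L) (m2lo m2hi m4hi : R) (m : kinetic_model R) :
  admissible V m2lo m2hi m4hi m ->
  sum_J L (fun j => dv V j * maxwellian V m j * vmid V j) = 0.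
Proof.
case: m => [Ms|M] /=.
  case=> _ [sr sl] M0 _.
  transitivity (sum_J L (fun j => (Ms (j - 1) - Ms j) * 1)).
    by apply: eq_sum_J => j jJ; rewrite mulr1 (maxwellian_of_starE (M0 _ jJ)).
  by rewrite (sum_J_by_parts (fun=> 1)) // big1 // => k _; rewrite subrr mulr0.
case=> _ Msym _; apply: sum_J_odd => j jJ.
rewrite vmid_odd // dv_even // mulrN; congr (- (_ * _ * _)).
move: jJ; rewrite /in_J => jJ; have [j1|j1] := lerP 1 j.
  by rewrite (Msym j) 1?addrC //; lia.
by rewrite Msym ?opprB ?subrK //; lia.
Qed.

(** * Fokker-Planck operator: conservation, momentum relaxation, spectral gap *)

Section FokkerPlanckCollision.
Variables (R : realType) (vstar : R) (L : nat) (V : velocity_mesh vstar L).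
Variables (N : nat) (X : space_mesh R N).
Variables (m2lo m2hi m4hi : R) (Ms : int -> R).
Hypotheses (L_gt0 : (0 < L)%N) (Ms_adm : A_FP V m2lo m2hi m4hi Ms).
Variables (f : 'I_N -> int -> R) (i : 'I_N).

Let M := maxwellian_of_star V Ms.
Let h j := f i j / M j.
Let G := FP_flux V X Ms f i.

Let G_left : G (- L%:Z) = 0. Proof. by rewrite /G /FP_flux eqxx. Qed.
Let G_right : G L%:Z = 0. Proof. by rewrite /G /FP_flux eqxx orbT. Qed.

Let in_J_face (k : 'I_L.*2.-1) :
  in_J L (1 - L%:Z + k%:Z) /\ in_J L (1 - L%:Z + k%:Z + 1).
Proof. by have := ltn_ord k; rewrite /in_J; lia. Qed.

Let FP_flux_in_J j : in_J L j -> in_J L (j + 1) ->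
  G j = X i * (Ms j * ((h (j + 1) - h j) / (vmid V (j + 1) - vmid V j))).
Proof.
rewrite /in_J => j0 j1; rewrite /G /FP_flux /dvface.
have -> : (j == - L%:Z) = false by apply/eqP; lia.
have -> : (j == L%:Z) = false by apply/eqP; lia.
by rewrite /= -/M -/(h _) -/(h _); ring.
Qed.

Let Ms_diff j : in_J L j -> Ms (j - 1) - Ms j = dv V j * M j * vmid V j.
Proof.
by move=> jJ; case: Ms_adm => _ _ M0 _; rewrite (maxwellian_of_starE (M0 _ jJ)).
Qed.

Let M_gt0 j : in_J L j -> 0 < M j.
Proof. by case: Ms_adm => _ _ M0 _; apply: M0. Qed.

Lemma FP_collision_mass :
  sum_J L (fun j => collision V X (FokkerPlanck Ms) f i j) = 0.
Proof.
transitivity (- sum_J L (fun j => (G (j - 1) - G j) * 1)).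
  by rewrite -sum_JN; apply: eq_sum_J => j _ /=; rewrite -/G; ring.
by rewrite (sum_J_by_parts (fun=> 1)) // big1 ?oppr0 // => k _; rewrite subrr mulr0.
Qed.

(** The velocity is an eigenvector for the eigenvalue -1: a first summation by parts cancels the
    [dvface] of the flux against the increment of [vmid], and a second one, backwards, moves the
    difference onto [Ms]. *)
Lemma FP_collision_momentum :
  sum_J L (fun j => vmid V j * collision V X (FokkerPlanck Ms) f i j)
    = - X i * sum_J L (fun j => dv V j * vmid V j * f i j).
Proof.
transitivity (- sum_J L (fun j => (G (j - 1) - G j) * vmid V j)).
  by rewrite -sum_JN; apply: eq_sum_J => j _ /=; rewrite -/G; ring.
rewrite sum_J_by_parts // mulNr; congr (- _).
transitivity (X i * sum_J L (fun j => (Ms (j - 1) - Ms j) * h j)).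
  have [_ [sr sl] _ _] := Ms_adm.
  rewrite sum_J_by_parts // mulr_sumr; apply: eq_bigr => k _.
  have [k0 k1] := in_J_face k; rewrite FP_flux_in_J // -!mulrA mulVf ?mulr1 //.
  by rewrite gt_eqF // subr_gt0 vmid_lt.
congr (_ * _); apply: eq_sum_J => j jJ; rewrite Ms_diff // /h.
by field; rewrite gt_eqF ?M_gt0.
Qed.

(** After summation by parts, the left side is minus the Dirichlet form of [h = f / M], and
    [discrete_poincare] bounds it by the variance of [h] under [dv * M]. *)
Lemma FP_collision_coercive :
  sum_J L (fun j => f i j / M j * collision V X (FokkerPlanck Ms) f i j)
    <= - X i * sum_J L (fun j =>
         (f i j - density V f i * M j) ^+ 2 * (M j)^-1 * dv V j).
Proof.
have -> : sum_J L (fun j => f i j / M j * collision V X (FokkerPlanck Ms) f i j)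
    = - sum_J L (fun j => (G (j - 1) - G j) * h j).
  by rewrite -sum_JN; apply: eq_sum_J => j _ /=; rewrite -/G -/(h j); ring.
rewrite sum_J_by_parts // mulNr lerN2.
have -> : \sum_(k < L.*2.-1) G (1 - L%:Z + k%:Z) *
      (h (1 - L%:Z + k%:Z + 1) - h (1 - L%:Z + k%:Z))
  = X i * \sum_(k < L.*2.-1) Ms (k.+1%:Z - L%:Z) *
      ((h (1 - L%:Z + k.+1%:Z) - h (1 - L%:Z + k%:Z)) ^+ 2
       / (vmid V (1 - L%:Z + k.+1%:Z) - vmid V (1 - L%:Z + k%:Z))).
  rewrite mulr_sumr; apply: eq_bigr => k _; have [k0 k1] := in_J_face k.
  rewrite FP_flux_in_J //.
  have -> : 1 - L%:Z + k.+1%:Z = 1 - L%:Z + k%:Z + 1 by lia.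
  have -> : k.+1%:Z - L%:Z = 1 - L%:Z + k%:Z by lia.
  by ring.
apply: ler_wpM2l; first exact/ltW/dx_gt0.
have Ln : L.*2 = L.*2.-1.+1 by lia.
have [_ [sr sl] _ _] := Ms_adm.
have mass := maxwellian_mass (m := FokkerPlanck Ms) Ms_adm.
set n := L.*2.-1 in Ln *.
(* Cell [k] has velocity index [1 - L + k]; the interface on its left has index [k - L], which fixes
   the shift in [s]. *)
apply: le_trans (@discrete_poincare _ n (fun k => vmid V (1 - L%:Z + k%:Z))
  (fun k => h (1 - L%:Z + k%:Z)) _
  (fun k => let j := 1 - L%:Z + k%:Z in dv V j * M j)
  (fun k => Ms (k%:Z - L%:Z)) _ _ _ _ _) => /=.
- have -> : density V f i
      = sum_J L (fun j => dv V j * M j * h j).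
    by apply: eq_sum_J => j jJ; rewrite /h; field; rewrite gt_eqF ?M_gt0.
  rewrite /sum_J Ln le_eqVlt; apply/orP; left; apply/eqP.
  apply: eq_bigr => k _; rewrite /h; field.
  by rewrite gt_eqF // M_gt0 // in_J_ord // Ln.
- move=> k kn; have -> : 1 - L%:Z + k.+1%:Z = 1 - L%:Z + k%:Z + 1 by lia.
  by apply: vmid_lt; rewrite /in_J; lia.
- by move=> k kn; apply/ltW/mulr_gt0; [apply: dv_gt0|apply: M_gt0]; rewrite /in_J; lia.
- by rewrite -mass /sum_J Ln.
- by rewrite sub0r.
- by have -> : n.+1%:Z - L%:Z = L by lia.
- move=> k kn; have -> : k.+1%:Z - L%:Z = 1 - L%:Z + k%:Z by lia.
  have -> : k%:Z - L%:Z = 1 - L%:Z + k%:Z - 1 by lia.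
  by rewrite Ms_diff //; rewrite /in_J; lia.
Qed.

End FokkerPlanckCollision.

(** * Properties shared by the two collision operators *)

Section Collision.
Variables (R : realType) (vstar : R) (L : nat) (V : velocity_mesh vstar L).
Variables (N : nat) (X : space_mesh R N).
Variables (m2lo m2hi m4hi : R) (m : kinetic_model R).
Hypotheses (L_gt0 : (0 < L)%N) (m_adm : admissible V m2lo m2hi m4hi m).
Variables (f : 'I_N -> int -> R) (i : 'I_N).

Let M := maxwellian V m.

Lemma collision_mass : sum_J L (fun j => collision V X m f i j) = 0.
Proof.
have := maxwellian_mass m_adm; case: m m_adm => [Ms|M0] /= adm mass.
  exact: FP_collision_mass.
transitivity (X i * (density V f i * sum_J L (fun j => dv V j * M0 j)
   - sum_J L (fun j => dv V j * f i j))).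
  by rewrite -sum_JZ -sum_JB -sum_JZ; apply: eq_sum_J => j _; ring.
by rewrite mass mulr1 subrr mulr0.
Qed.

Lemma collision_momentum :
  sum_J L (fun j => vmid V j * collision V X m f i j)
    = - X i * sum_J L (fun j => dv V j * vmid V j * f i j).
Proof.
have := maxwellian_mean m_adm; case: m m_adm => [Ms|M0] /= adm mean.
  exact: (FP_collision_momentum X L_gt0 adm).
transitivity (X i * (density V f i * sum_J L (fun j => dv V j * M0 j * vmid V j)
   - sum_J L (fun j => dv V j * vmid V j * f i j))).
  by rewrite -sum_JZ -sum_JB -sum_JZ; apply: eq_sum_J => j _; ring.
by rewrite mean mulr0 sub0r mulrN mulNr.
Qed.

Lemma collision_coercive :
  sum_J L (fun j => f i j / M j * collision V X m f i j)
    <= - X i * sum_J L (fun j =>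
         (f i j - density V f i * M j) ^+ 2 * (M j)^-1 * dv V j).
Proof.
have := maxwellian_mass m_adm; have := maxwellian_gt0 m_adm; rewrite /M.
case: m m_adm => [Ms|M0] /= adm M_gt0 mass.
  exact: (FP_collision_coercive X L_gt0 adm).
set r := density V f i.
rewrite le_eqVlt; apply/orP; left; apply/eqP.
(* [rho M] is orthogonal to [f - rho M]. *)
have orth : sum_J L (fun j => dv V j * (f i j - r * M0 j)) = 0.
  transitivity (r - r * sum_J L (fun j => dv V j * M0 j)).
    by rewrite -sum_JZ -sum_JB; apply: eq_sum_J => j _; ring.
  by rewrite mass mulr1 subrr.
clearbody r; transitivity (- X i *
     sum_J L (fun j => (f i j - r * M0 j) ^+ 2 * (M0 j)^-1 * dv V j)
   - X i * r * sum_J L (fun j => dv V j * (f i j - r * M0 j))).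
  rewrite -!sum_JZ -sum_JB; apply: eq_sum_J => j jJ; field.
  by rewrite gt_eqF ?M_gt0.
by rewrite orth mulr0 subr0.
Qed.

End Collision.

(** * Space discretization and moment equations *)

Section SpaceMesh.
Variables (R : realType) (N : nat) (X : space_mesh R N).
Implicit Types (a b F phi rho : 'I_N -> R).

(** The face averages combine into a centred difference over two cells, which links only points two
    steps apart; this is where the parity of [N] matters. *)
Lemma mulr_Dx phi i : X i * Dx X phi i = (phi (ordS i) - phi (ord_pred i)) / 2.
Proof.
rewrite /Dx mulrC divfK ?gt_eqF ?dx_gt0 // /at_face ord_predK.
by rewrite -mulrBl; congr (_ / _); ring.
Qed.

Lemma sum_Dx phi : \sum_i X i * Dx X phi i = 0.
Proof.
under eq_bigr do rewrite mulr_Dx.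
by rewrite -mulr_suml sumrB sum_ordS sum_ord_pred subrr mul0r.
Qed.

(** When [b] is a field [Dx X phi], the right-hand factor is the left side of the Poisson
    equation. *)
Lemma sum_Dx_by_parts a b :
  \sum_i X i * Dx X a i * b i = \sum_i a i * ((b (ord_pred i) - b (ordS i)) / 2).
Proof.
have Hl : \sum_i a (ordS i) * b i = \sum_i a i * b (ord_pred i).
  by rewrite -[RHS]sum_ordS; apply: eq_bigr => i _; rewrite ordSK.
have Hr : \sum_i a (ord_pred i) * b i = \sum_i a i * b (ordS i).
  by rewrite -[RHS]sum_ord_pred; apply: eq_bigr => i _; rewrite ord_predK.
transitivity ((\sum_i a (ordS i) * b i - \sum_i a (ord_pred i) * b i) / 2).
  by rewrite -sumrB mulr_suml; apply: eq_bigr => i _; rewrite mulr_Dx; ring.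
by rewrite Hl Hr -sumrB mulr_suml; apply: eq_bigr => i _; ring.
Qed.

(** Since the cell lengths sum to 1, [F i] is the average of the differences [F i - F k], each
    controlled by the oscillation along the cycle. *)
Lemma mean_zero_bound F i : odd N -> \sum_k X k * F k = 0 ->
  `|F i| <= \sum_l `|F (ordS l) - F (ord_pred l)|.
Proof.
move=> oddN F0; set S := \sum_l _.
have -> : F i = \sum_k X k * (F i - F k).
  under eq_bigr do rewrite mulrBr.
  by rewrite sumrB F0 subr0 -mulr_suml dx_sum mul1r.
apply: (le_trans (ler_norm_sum _ _ _)).
have -> : S = \sum_k X k * S by rewrite -mulr_suml dx_sum mul1r.
apply: ler_sum => k _; rewrite normrM gtr0_norm ?dx_gt0 // ler_wpM2l //.
  exact/ltW/dx_gt0.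
exact: odd_cycle_oscillation.
Qed.

Lemma sqnormE rho : sqnorm X rho = \sum_i X i * rho i ^+ 2.
Proof. by apply: eq_bigr => i _; rewrite real_normK ?num_real // mulrC. Qed.

Lemma sqr_sum_norm_le rho : (\sum_i X i * `|rho i|) ^+ 2 <= sqnorm X rho.
Proof.
have := cauchy_schwarz_sum (fun=> 1) (fun i => `|rho i|) (fun i => ltW (dx_gt0 X i)).
under eq_bigr do rewrite mul1r.
under [X in _ <= X * _]eq_bigr do rewrite expr1n mulr1.
rewrite dx_sum mul1r => /le_trans; apply.
by rewrite le_eqVlt; apply/orP; left; apply/eqP; apply: eq_bigr => i _; rewrite mulrC.
Qed.

Lemma poisson_central rho phi i : poisson X rho phi ->
  Dx X phi (ordS i) - Dx X phi (ord_pred i) = - (2 * (X i * rho i)).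
Proof. by case=> /(_ i) <- _; field. Qed.

(** The centred jumps of the field are [2 * (X i * rho i)] up to sign, so its sup norm is at most
    twice the L1 norm of [rho]; squaring gives the constant 4. *)
Lemma poisson_estimate rho phi : odd N -> poisson X rho phi ->
  \sum_i X i * Dx X phi i ^+ 2 <= 4 * sqnorm X rho.
Proof.
move=> oddN pois; set B := \sum_i X i * `|rho i|.
have bound i : `|Dx X phi i| <= 2 * B.
  apply: (le_trans (mean_zero_bound i oddN (sum_Dx phi))).
  rewrite mulr_sumr; apply: ler_sum => l _.
  rewrite (poisson_central _ pois) normrN !normrM (gtr0_norm (dx_gt0 X l)).
  by rewrite ger0_norm.
apply: (@le_trans _ _ (4 * B ^+ 2)); last first.
  by rewrite ler_wpM2l // sqr_sum_norm_le.
have -> : 4 * B ^+ 2 = \sum_i X i * (2 * B) ^+ 2.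
  by rewrite -mulr_suml dx_sum; ring.
apply: ler_sum => i _; apply: ler_wpM2l; first exact/ltW/dx_gt0.
have B0 := le_trans (normr_ge0 _) (bound i).
rewrite -(@real_normK _ (Dx X phi i)) ?num_real //.
by rewrite ler_pXn2r ?nnegrE ?bound.
Qed.

(* The field moves by the current minus its mean, so that the increment of the
   potential needs no elliptic estimate. *)
Lemma poisson_increment dt rho rho' phi phi' a i : odd N ->
  poisson X rho phi -> poisson X rho' phi' ->
  (forall k, X k * (rho' k - rho k) = - dt * (X k * Dx X a k)) ->
  Dx X phi' i - Dx X phi i = dt * (a i - \sum_k X k * a k).
Proof.
move=> oddN pois pois' cont; set mu := \sum_k X k * a k.
(* The defect [F] has zero mean and zero centred jumps, so [mean_zero_bound] makes it vanish. *)
pose F k := Dx X phi' k - Dx X phi k - dt * (a k - mu).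
have F0 : \sum_k X k * F k = 0.
  transitivity (\sum_k X k * Dx X phi' k - \sum_k X k * Dx X phi k
      - dt * (\sum_k X k * a k - mu * \sum_k X k)).
    rewrite mulr_sumr -!sumrB mulr_sumr -sumrB.
    by apply: eq_bigr => k _; rewrite /F; ring.
  by rewrite !sum_Dx dx_sum mulr1 !subrr mulr0 subr0.
suff : F i = 0 by rewrite /F; lra.
apply/normr0_eq0/le_anti; rewrite normr_ge0 andbT.
apply: (le_trans (mean_zero_bound i oddN F0)); rewrite big1 // => l _.
apply/eqP; rewrite normr_eq0; apply/eqP.
have := poisson_central l pois; have := poisson_central l pois'.
have := cont l; rewrite mulr_Dx /F; lra.
Qed.

End SpaceMesh.

(** * Fluctuations around local equilibrium and moment bounds *)

Section Fluctuation.
Variables (R : realType) (vstar : R) (L : nat) (V : velocity_mesh vstar L).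
Variable (N : nat).
Implicit Types (M : int -> R) (u : 'I_N -> int -> R).

Definition fluctuation M u i j : R := u i j - density V u i * M j.

Definition cell_sqnorm M u i : R :=
  sum_J L (fun j => u i j ^+ 2 * (M j)^-1 * dv V j).

Definition second_moment u i : R := sum_J L (fun j => dv V j * vmid V j ^+ 2 * u i j).

Lemma sqnorm_gammaE (X : space_mesh R N) M u :
  sqnorm_gamma V X M u = \sum_i X i * cell_sqnorm M u i.
Proof.
apply: eq_bigr => i _; rewrite -sum_JZ; apply: eq_sum_J => j _.
by rewrite real_normK ?num_real //; ring.
Qed.

Lemma second_moment_split M u i :
  second_moment u i
    = moment V 2 M * density V u i + second_moment (fluctuation M u) i.
Proof.
rewrite mulrC -sum_JZ -sum_JD; apply: eq_sum_J => j _.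
by rewrite real_normK ?num_real // /fluctuation; ring.
Qed.

Variables (m2lo m2hi m4hi : R) (m : kinetic_model R).
Hypothesis m_adm : admissible V m2lo m2hi m4hi m.

Let M := maxwellian V m.

Lemma cell_sqnorm_ge0 u i : 0 <= cell_sqnorm M u i.
Proof.
apply: sum_J_ge0 => j jJ.
apply: mulr_ge0 (ltW (dv_gt0 V jJ)); apply: mulr_ge0 (sqr_ge0 _) _.
by rewrite invr_ge0 ltW ?(maxwellian_gt0 m_adm).
Qed.

(** Cauchy-Schwarz for the measure [dv * M], applied to [c] and [u / M]. *)
Lemma weighted_cell_bound (c : int -> R) u i :
  sum_J L (fun j => dv V j * c j * u i j) ^+ 2
    <= sum_J L (fun j => dv V j * M j * c j ^+ 2) * cell_sqnorm M u i.
Proof.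
have M0 j : in_J L j -> M j != 0 by move=> jJ; rewrite gt_eqF ?(maxwellian_gt0 m_adm).
have w0 j : in_J L j -> 0 <= dv V j * M j.
  by move=> jJ; rewrite ltW ?(maxwellian_weight_gt0 m_adm).
have -> : sum_J L (fun j => dv V j * c j * u i j)
    = sum_J L (fun j => dv V j * M j * (c j * (u i j / M j))).
  by apply: eq_sum_J => j jJ; field; rewrite M0.
have -> : cell_sqnorm M u i = sum_J L (fun j => dv V j * M j * (u i j / M j) ^+ 2).
  by apply: eq_sum_J => j jJ; field; rewrite M0.
exact: cauchy_schwarz_sum_J.
Qed.

(** The Maxwellian carries no momentum, so the flux sees only the fluctuation. *)
Lemma flux_bound eps u i : 0 < eps ->
  eps ^+ 2 * flux V eps u i ^+ 2 <= m2hi * cell_sqnorm M (fluctuation M u) i.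
Proof.
move=> eps_gt0; have [_ _ m2 _] := maxwellian_moments m_adm.
rewrite -exprMn /flux mulrA divff ?gt_eqF // mul1r.
have -> : sum_J L (fun j => dv V j * vmid V j * u i j)
    = sum_J L (fun j => dv V j * vmid V j * fluctuation M u i j).
  transitivity (sum_J L (fun j => dv V j * vmid V j * fluctuation M u i j)
    + density V u i * sum_J L (fun j => dv V j * M j * vmid V j)).
    by rewrite -sum_JZ -sum_JD; apply: eq_sum_J => j _; rewrite /fluctuation; ring.
  by rewrite (maxwellian_mean m_adm) mulr0 addr0.
apply: (le_trans (weighted_cell_bound _ _ _)); apply: ler_wpM2r.
  exact: cell_sqnorm_ge0.
apply: le_trans m2; apply: ler_sum_J => j _.
by rewrite real_normK ?num_real // -/M; lra.
Qed.

Lemma second_moment_bound u i : second_moment u i ^+ 2 <= m4hi * cell_sqnorm M u i.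
Proof.
have [_ _ _ m4] := maxwellian_moments m_adm.
apply: (le_trans (weighted_cell_bound (fun j => vmid V j ^+ 2) _ _)).
apply: ler_wpM2r; first exact: cell_sqnorm_ge0.
apply: le_trans m4; apply: ler_sum_J => j _.
by rewrite (exprM `|_| 2 2) real_normK ?num_real // -/M; lra.
Qed.

End Fluctuation.

(** * Balance laws of one implicit time step *)

Section SchemeStep.
Variables (R : realType) (vstar : R) (L : nat) (V : velocity_mesh vstar L).
Variables (N : nat) (X : space_mesh R N).
Variables (m2lo m2hi m4hi : R) (m : kinetic_model R).
Hypotheses (L_gt0 : (0 < L)%N) (m_adm : admissible V m2lo m2hi m4hi m).
Variables (eps dt : R) (u u' : 'I_N -> int -> R).
Hypothesis eps_gt0 : 0 < eps.
Hypothesis step : forall i j, in_J L j ->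
  eps * X i * dv V j * (u' i j - u i j)
  + dt * (transport_flux V u' i j - transport_flux V u' (ord_pred i) j)
  = dt / eps * collision V X m u' i j.

Let M := maxwellian V m.
Let rho := density V u'.
Let g := fluctuation V M u'.
Let J := flux V eps u'.
Let S := second_moment V u'.
Let cell := cell_sqnorm V M g.

Lemma transport_flux_diff (v : 'I_N -> int -> R) i j :
  transport_flux V v i j - transport_flux V v (ord_pred i) j
    = dv V j * vmid V j * ((v (ordS i) j - v (ord_pred i) j) / 2).
Proof. by rewrite /transport_flux ord_predK; ring. Qed.

(** The weights [1], [vmid] and [u' i / M] give respectively the mass, momentum and entropy
    balances. *)
Lemma scheme_weighted (c : int -> R) i :
  eps * X i * (sum_J L (fun j => c j * (dv V j * u' i j))
               - sum_J L (fun j => c j * (dv V j * u i j)))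
  + dt * sum_J L (fun j => c j *
      (dv V j * vmid V j * ((u' (ordS i) j - u' (ord_pred i) j) / 2)))
  = dt / eps * sum_J L (fun j => c j * collision V X m u' i j).
Proof.
rewrite -sum_JB -!sum_JZ -sum_JD; apply: eq_sum_J => j jJ.
rewrite [RHS]mulrCA -(step i jJ) transport_flux_diff; ring.
Qed.

Lemma scaled_fluxE (v : 'I_N -> int -> R) i :
  sum_J L (fun j => dv V j * vmid V j * v i j) = eps * flux V eps v i.
Proof. by rewrite /flux mulrA divff ?mul1r ?gt_eqF. Qed.

Lemma scheme_mass i :
  X i * (rho i - density V u i) = - dt * (X i * Dx X J i).
Proof.
have := scheme_weighted (fun=> 1) i.
rewrite [in X in _ = _ * X](eq_sum_J (fun _ _ => mul1r _)).
rewrite (collision_mass X m_adm) mulr0 mulr_Dx.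
have density_sum (v : 'I_N -> int -> R) :
    sum_J L (fun j => 1 * (dv V j * v i j)) = density V v i.
  by apply: eq_sum_J => j _; rewrite mul1r.
rewrite !density_sum -/rho.
have -> : sum_J L (fun j => 1 *
      (dv V j * vmid V j * ((u' (ordS i) j - u' (ord_pred i) j) / 2)))
    = eps * ((J (ordS i) - J (ord_pred i)) / 2).
  transitivity (2^-1 * (eps * J (ordS i) - eps * J (ord_pred i))); last by ring.
  by rewrite -!scaled_fluxE -sum_JB -sum_JZ; apply: eq_sum_J => j _; ring.
move=> E; apply: (mulfI (lt0r_neq0 eps_gt0)); lra.
Qed.

Lemma scheme_momentum i :
  eps ^+ 2 * (X i * (J i - flux V eps u i))
    = - dt * (X i * Dx X S i + X i * J i).
Proof.
have := scheme_weighted (vmid V) i.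
rewrite (collision_momentum X L_gt0 m_adm) scaled_fluxE mulr_Dx -/J.
have flux_sum (v : 'I_N -> int -> R) :
    sum_J L (fun j => vmid V j * (dv V j * v i j)) = eps * flux V eps v i.
  by rewrite -scaled_fluxE; apply: eq_sum_J => j _; ring.
rewrite !flux_sum -/J.
have -> : sum_J L (fun j => vmid V j *
      (dv V j * vmid V j * ((u' (ordS i) j - u' (ord_pred i) j) / 2)))
    = (S (ordS i) - S (ord_pred i)) / 2.
  by rewrite mulrC -sum_JB -sum_JZ; apply: eq_sum_J => j _; ring.
have -> : dt / eps * (- X i * (eps * J i)) = - dt * (X i * J i).
  by field; rewrite gt_eqF.
by move=> E; lra.
Qed.

Lemma scheme_entropy : 0 < dt ->
  2^-1 * (sqnorm_gamma V X M u' - sqnorm_gamma V X M u)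
    <= - (dt / eps ^+ 2) * \sum_i X i * cell i.
Proof.
move=> dt_gt0.
pose transport i := sum_J L (fun j => u' i j / M j *
  (dv V j * vmid V j * ((u' (ordS i) j - u' (ord_pred i) j) / 2))).
(* At each fixed velocity the centred difference is antisymmetric, so its quadratic form equals its
   own opposite. *)
have transport0 : \sum_i transport i = 0.
  rewrite /transport /sum_J exchange_big big1 // => k _ /=.
  move: (1 - L%:Z + k%:Z) => j; pose a i := u' i j.
  transitivity (dv V j * vmid V j / M j * \sum_i X i * Dx X a i * a i).
    by rewrite mulr_sumr; apply: eq_bigr => i _; rewrite mulr_Dx /a; ring.
  suff : \sum_i X i * Dx X a i * a i = - \sum_i X i * Dx X a i * a i.
    by move=> H; have -> : \sum_i X i * Dx X a i * a i = 0 by [lra]; rewrite mulr0.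
  by rewrite {1}sum_Dx_by_parts -sumrN; apply: eq_bigr => i _; rewrite mulr_Dx; ring.
rewrite !sqnorm_gammaE.
have cell_step i : X i * (2^-1 * (sum_J L (fun j => u' i j ^+ 2 * (M j)^-1 * dv V j)
      - sum_J L (fun j => u i j ^+ 2 * (M j)^-1 * dv V j)))
    <= - (dt / eps ^+ 2) * (X i * cell i) - dt / eps * transport i.
  have := scheme_weighted (fun j => u' i j / M j) i; rewrite -/(transport i).
  have := collision_coercive X L_gt0 m_adm u' i; rewrite -/M.
  set Q := sum_J L (fun j => _ * collision _ _ _ _ _ _).
  rewrite -/(cell_sqnorm V M g i) -/(cell i) => HQ E.
  set a := sum_J L (fun j => _ * (dv V j * u' i j)) in E.
  set b := sum_J L (fun j => _ * (dv V j * u i j)) in E.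
  (* Implicit Euler convexity: [x * (x - y)] exceeds [(x ^+ 2 - y ^+ 2) / 2] by
     [(x - y) ^+ 2 / 2]. *)
  have sq : 2^-1 * (sum_J L (fun j => u' i j ^+ 2 * (M j)^-1 * dv V j)
      - sum_J L (fun j => u i j ^+ 2 * (M j)^-1 * dv V j)) <= a - b.
    rewrite /a /b -!sum_JB -sum_JZ; apply: ler_sum_J => j jJ.
    have w0 : 0 <= dv V j / M j.
      by rewrite divr_ge0 ?ltW ?dv_gt0 ?(maxwellian_gt0 m_adm).
    rewrite -subr_ge0.
    suff -> : forall x y W d : R, x / W * (d * x) - x / W * (d * y)
        - 2^-1 * (x ^+ 2 / W * d - y ^+ 2 / W * d) = 2^-1 * (d / W) * (x - y) ^+ 2.
      by apply: mulr_ge0 (sqr_ge0 _); apply: mulr_ge0 w0; rewrite invr_ge0.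
    by move=> x y W d; move: W^-1 => w; field.
  apply: (le_trans (ler_wpM2l (ltW (dx_gt0 X i)) sq)).
  have -> : X i * (a - b) = eps^-1 * (dt / eps * Q - dt * transport i).
    by rewrite -E; field; rewrite gt_eqF.
  have -> : - (dt / eps ^+ 2) * (X i * cell i) - dt / eps * transport i
      = eps^-1 * (dt / eps * (- X i * cell i) - dt * transport i).
    by field; rewrite gt_eqF.
  rewrite ler_pM2l ?invr_gt0 // lerD2r ler_pM2l ?divr_gt0 //.
have -> : - (dt / eps ^+ 2) * (\sum_i X i * cell i)
    = \sum_i (- (dt / eps ^+ 2) * (X i * cell i) - dt / eps * transport i).
  by rewrite sumrB -!mulr_sumr transport0 mulr0 subr0.
by rewrite -sumrB mulr_sumr; apply: ler_sum => i _; rewrite -mulrBr mulrCA.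
Qed.

(** The momentum balance is tested with the new field; by parts, the Poisson equation turns the
    gradient of [S] into [S] against [rho], and [S] splits into equilibrium part and fluctuation. *)
Lemma corrector_increment (phi : 'I_N -> R) :
  poisson X rho phi ->
  eps ^+ 2 * \sum_i X i * ((J i - flux V eps u i) * Dx X phi i)
    = - dt * (moment V 2 M * sqnorm X rho
              + \sum_i X i * (rho i * second_moment V g i)
              + \sum_i X i * (J i * Dx X phi i)).
Proof.
case=> pois _.
have SR : \sum_i X i * Dx X S i * Dx X phi i
    = moment V 2 M * sqnorm X rho + \sum_i X i * (rho i * second_moment V g i).
  rewrite sum_Dx_by_parts sqnormE mulr_sumr -big_split /=; apply: eq_bigr => i _.
  have -> : (Dx X phi (ord_pred i) - Dx X phi (ordS i)) / 2 = X i * rho i.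
    by rewrite -pois; ring.
  by rewrite /S (second_moment_split V M) -/g -/rho; ring.
rewrite -SR -big_split !mulr_sumr /=; apply: eq_bigr => i _.
transitivity (eps ^+ 2 * (X i * (J i - flux V eps u i)) * Dx X phi i).
  by ring.
by rewrite scheme_momentum; ring.
Qed.

End SchemeStep.

(** * Entropy dissipation *)

(* The last two terms of the entropy are designed so that the implicit Euler
   remainder [<J' - J, Phi' - Phi>] is absorbed. *)
Lemma corrector_time_increment (R : realType) (N : nat) (X : space_mesh R N)
    (dt : R) (J J' Phi_ Phi Phi' : 'I_N -> R) :
  0 < dt ->
  (forall i, Phi i - Phi_ i = dt * (J i - \sum_k X k * J k)) ->
  (forall i, Phi' i - Phi i = dt * (J' i - \sum_k X k * J' k)) ->
  (\sum_i X i * J' i * Phi' i - \sum_i X i * J i * Phi i)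
  + 2^-1 * (\sum_i X i * ((Phi' i - Phi i) ^+ 2 / dt)
            - \sum_i X i * ((Phi i - Phi_ i) ^+ 2 / dt))
    <= \sum_i X i * ((J' i - J i) * Phi' i) + dt * \sum_i X i * J' i ^+ 2.
Proof.
move=> dt_gt0; set mu := \sum_k X k * J k; set mu' := \sum_k X k * J' k => incr incr'.
have centered : \sum_i X i * (J' i - mu') = 0.
  under eq_bigr do rewrite mulrBr.
  by rewrite sumrB -mulr_suml dx_sum mul1r subrr.
clearbody mu mu'; rewrite -subr_ge0; set lhs := (X in _ - X).
(* The slack is a sum of squares, plus a multiple of the mean of the centred flux, which is zero. *)
have -> : \sum_i X i * ((J' i - J i) * Phi' i) + dt * (\sum_i X i * J' i ^+ 2) - lhs
   = \sum_i X i * (dt * (2^-1 * ((J' i - mu') - (J i - mu)) ^+ 2 + mu' ^+ 2))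
     + dt * (2 * mu' - mu) * \sum_i X i * (J' i - mu').
  rewrite /lhs -!sumrB !mulr_sumr -!big_split -sumrB /=; apply: eq_bigr => i _.
  rewrite incr incr' -(subrK (Phi i) (Phi' i)) incr'; field.
  by rewrite gt_eqF.
rewrite centered mulr0 addr0; apply: sumr_ge0 => i _.
apply: mulr_ge0 (ltW (dx_gt0 X i)) _; apply: mulr_ge0 (ltW dt_gt0) _.
by apply: addr_ge0 (sqr_ge0 _); apply: mulr_ge0 (sqr_ge0 _); rewrite invr_ge0.
Qed.

(* The weight 1/16 anticipates [|Phi|^2 <= 4 |rho|^2]: the first two terms then
   use exactly half of the dissipation [m2lo |rho|^2]. *)
Lemma young_coupling (R : realFieldType) (m2lo m2hi m4 E r : R) (a T J P : R) :
  0 < m2lo -> 0 < E ->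
  T ^+ 2 <= m4 * a -> E ^+ 2 * J ^+ 2 <= m2hi * a ->
  - (r * T) - J * P
    <= m2lo / 4 * r ^+ 2 + m2lo / 16 * P ^+ 2 + (m4 + 4 * m2hi / E ^+ 2) / m2lo * a.
Proof.
move=> m2lo_gt0 E_gt0 HT HJ.
have HJ' : J ^+ 2 <= m2hi / E ^+ 2 * a.
  by rewrite mulrAC ler_pdivlMr ?exprn_gt0 // mulrC.
have -> : (m4 + 4 * m2hi / E ^+ 2) / m2lo * a
    = m2lo^-1 * (m4 * a) + 4 * m2lo^-1 * (m2hi / E ^+ 2 * a) by ring.
have s0 : 0 < m2lo^-1 by rewrite invr_gt0.
have ms : m2lo * m2lo^-1 = 1 by rewrite divff ?gt_eqF.
move: s0 ms; set s := m2lo^-1 => s0 ms.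
have h1 := ler_wpM2l (ltW s0) HT.
have h2 := ler_wpM2l (ltW s0) HJ'.
(* With [s = 1 / m2lo], these squares are the two Young inequalities, for [r * T] and for [J * P];
   replacing [m2lo * s] by 1 afterwards leaves a linear problem. *)
have q1 : 0 <= s * (m2lo / 2 * r + T) ^+ 2 by rewrite mulr_ge0 ?sqr_ge0 // ltW.
have q2 : 0 <= s * (m2lo / 4 * P + 2 * J) ^+ 2 by rewrite mulr_ge0 ?sqr_ge0 // ltW.
have e1 : s * (m2lo / 2 * r + T) ^+ 2
    = m2lo / 4 * r ^+ 2 * (m2lo * s) + r * T * (m2lo * s) + s * T ^+ 2 by field.
have e2 : s * (m2lo / 4 * P + 2 * J) ^+ 2
    = m2lo / 16 * P ^+ 2 * (m2lo * s) + J * P * (m2lo * s) + 4 * (s * J ^+ 2) by field.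
rewrite e1 ms in q1; rewrite e2 ms in q2.
clearbody s; lra.
Qed.

(** [eta2] is chosen before the meshes, the Maxwellian, [eps] and [dt], so the smallness condition
    is uniform in all of them. *)
Theorem proposition3 (R : realType) (m2lo m2hi m4hi dtmax : R) :
  0 < m2lo -> m2lo <= m2hi -> 0 < dtmax ->
  exists eta2 : R, 0 < eta2 /\
    forall (vstar : R) (L : nat) (V : velocity_mesh vstar L)
           (N : nat) (X : space_mesh R N) (m : kinetic_model R),
      0 < vstar -> (1 <= L)%N -> odd N -> admissible V m2lo m2hi m4hi m ->
    forall (eps dt eta : R),
      0 < eps -> eps <= 1 -> 0 < dt -> dt <= dtmax -> 0 < eta -> eta <= eta2 ->
    forall (f : nat -> 'I_N -> int -> R) (phi : nat -> 'I_N -> R),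
      \sum_i sum_J L (fun j => X i * dv V j * f 0%N i j) = 0 ->
      scheme V X m eps dt f ->
      (forall n, poisson X (density V (f n)) (phi n)) ->
    forall n : nat, (1 <= n)%N ->
      let M := maxwellian V m in
      let H := entropy V X M eps dt eta f phi in
      let K := 2^-1 * Num.min (1 - eta * m2hi) (eta * m2lo) in
      let rho := density V (f n.+1) in
      (H n.+1 - H n) / dt
      + K * (sqnorm_gamma V X M (fun i j => f n.+1 i j - rho i * M j)
             + sqnorm X rho)
      <= 0.
Proof.
move=> m2lo_gt0 m2lohi dtmax_gt0.
have m2hi_gt0 := lt_le_trans m2lo_gt0 m2lohi.
(* Total Young cost of the cross terms when [eps <= 1], up to the factor [1 / m2lo]; the absolute
   value makes it positive. *)
pose A : R := `|m4hi| + 4 * m2hi.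
have A_gt0 : 0 < A by rewrite ltr_wpDl ?normr_ge0 // mulr_gt0.
have D_gt0 : 0 < 2 * A + m2lo * m2hi by rewrite addr_gt0 ?mulr_gt0.
(* This threshold is exactly [eta * A / m2lo <= (1 - eta * m2hi) / 2]: the cross terms consume at
   most half of the available dissipation. *)
exists (m2lo / (2 * A + m2lo * m2hi)); split; first by rewrite divr_gt0.
move=> vstar L V N X m vstar_gt0 L_gt0 oddN adm eps dt eta eps_gt0 eps_le1 dt_gt0 _
  eta_gt0; rewrite ler_pdivlMr // => eta_le f phi _ sch pois [//|n] _.
(* The current time is now [n.+1], the new one [n.+2], and the entropy at the current time reaches
   back to [phi n]. *)
cbv zeta; set M := maxwellian V m; set H := entropy V X M eps dt eta f phi.
set K := 2^-1 * Num.min _ _; set rho := density V (f n.+2).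
pose J k := flux V eps (f k).
pose Phi k := Dx X (phi k).
pose g := fluctuation V M (f n.+2).
pose T := second_moment V g.
pose G := \sum_i X i * cell_sqnorm V M g i.
pose r2 := sqnorm X rho.
pose E k := sqnorm_gamma V X M (f k).
pose C k := \sum_i X i * J k i * Phi k i.
pose D k := \sum_i X i * ((Phi k.+1 i - Phi k i) ^+ 2 / dt).
pose JJ := \sum_i X i * J n.+2 i ^+ 2.
pose dJP := \sum_i X i * ((J n.+2 i - J n.+1 i) * Phi n.+2 i).
pose JP := \sum_i X i * (J n.+2 i * Phi n.+2 i).
pose RT := \sum_i X i * (rho i * T i).
pose P2 := \sum_i X i * Phi n.+2 i ^+ 2.
have sqg : sqnorm_gamma V X M g = G := sqnorm_gammaE V X M g.
have Phi_incr k i : Phi k.+1 i - Phi k i = dt * (J k.+1 i - \sum_l X l * J k.+1 l).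
  apply: (poisson_increment i oddN (pois k) (pois k.+1)) => l.
  exact: (scheme_mass adm eps_gt0 (sch k)).
(* True by computation: at time [k.+1] the predecessor reduces to [k], so [D k] belongs to the
   entropy at [k.+1]. *)
have H_E k : H k.+1 = 2^-1 * E k.+1 + eta * eps ^+ 2 * C k.+1
    + eta * eps ^+ 2 / 2 * D k by [].
have dissip : 2^-1 * (E n.+2 - E n.+1) <= - (dt / eps ^+ 2) * G :=
  scheme_entropy L_gt0 adm eps_gt0 (sch n.+1) dt_gt0.
have corr : eps ^+ 2 * dJP = - dt * (moment V 2 M * r2 + RT + JP) :=
  corrector_increment L_gt0 adm eps_gt0 (sch n.+1) (pois n.+2).
have time : C n.+2 - C n.+1 + 2^-1 * (D n.+1 - D n) <= dJP + dt * JJ :=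
  corrector_time_increment dt_gt0 (Phi_incr n) (Phi_incr n.+1).
have P2_le : P2 <= 4 * r2 := poisson_estimate oddN (pois n.+2).
have m2_ge : m2lo <= moment V 2 M by case: (maxwellian_moments adm).
have cell0 i : 0 <= cell_sqnorm V M g i := cell_sqnorm_ge0 adm g i.
have r2_ge0 : 0 <= r2.
  by apply: sumr_ge0 => i _; rewrite mulr_ge0 ?exprn_ge0 // ltW ?dx_gt0.
have G_ge0 : 0 <= G by apply: sumr_ge0 => i _; rewrite mulr_ge0 // ltW ?dx_gt0.
have fluxes : eps ^+ 2 * JJ <= m2hi * G.
  rewrite /JJ /G !mulr_sumr; apply: ler_sum => i _; rewrite !(mulrCA _ (X i)).
  by apply: ler_wpM2l; [exact/ltW/dx_gt0 | apply: (flux_bound adm)].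
have coupling : - RT - JP
    <= m2lo / 2 * r2 + (A / m2lo) * (G / eps ^+ 2).
  apply: (@le_trans _ _ (m2lo / 4 * r2 + m2lo / 16 * P2
     + (`|m4hi| + 4 * m2hi / eps ^+ 2) / m2lo * G)).
    rewrite /RT /JP /G /P2 /r2 sqnormE !mulr_sumr -!big_split -sumrN -sumrB /=.
    apply: ler_sum => i _.
    have X0 := ltW (dx_gt0 X i).
    have HT : T i ^+ 2 <= `|m4hi| * cell_sqnorm V M g i.
      apply: (le_trans (second_moment_bound adm _ _)).
      by rewrite ler_wpM2r // ler_norm.
    have HJ : eps ^+ 2 * J n.+2 i ^+ 2 <= m2hi * cell_sqnorm V M g i 
      by apply: (flux_bound adm).
    have := ler_wpM2l X0 (young_coupling (rho i) (Phi n.+2 i) m2lo_gt0 eps_gt0 HT HJ).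
    lra.
  (* Here [eps <= 1] lets the fourth moment term be charged to [G / eps ^+ 2]. *)
  have : (`|m4hi| + 4 * m2hi / eps ^+ 2) / m2lo * G <= (A / m2lo) * (G / eps ^+ 2).
    have -> : (A / m2lo) * (G / eps ^+ 2) = (A / eps ^+ 2) / m2lo * G by ring.
    apply: ler_wpM2r => //; apply: ler_wpM2r; first by rewrite invr_ge0 ltW.
    rewrite /A (mulrDl `|m4hi|) lerD2r ler_peMr ?normr_ge0 // invf_ge1 ?exprn_gt0 //.
    by rewrite exprn_ile1 // ltW.
  have := ler_wpM2l (ltW m2lo_gt0) P2_le; lra.
pose Ge := G / eps ^+ 2.
have G_le : G <= Ge.
  by rewrite /Ge ler_peMr // invf_ge1 ?exprn_gt0 // exprn_ile1 // ltW.
have main : (H n.+2 - H n.+1) / dt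
    <= - Ge + eta * (- (m2lo * r2) + (m2lo / 2 * r2 + A / m2lo * Ge) + m2hi * G).
  rewrite ler_pdivrMr // !H_E.
  have m2_r2 := ler_wpM2r r2_ge0 m2_ge.
  have c1 := ler_wpM2l (ltW (mulr_gt0 eta_gt0 dt_gt0)) coupling.
  have c2 := ler_wpM2l (ltW (mulr_gt0 eta_gt0 dt_gt0)) fluxes.
  have c3 := ler_wpM2l (ltW (mulr_gt0 eta_gt0 dt_gt0)) m2_r2.
  have t := ler_wpM2l (ltW (mulr_gt0 eta_gt0 (exprn_gt0 2 eps_gt0))) time.
  have d : - (dt / eps ^+ 2) * G = - (dt * Ge) by rewrite /Ge; ring.
  rewrite d in dissip; rewrite -/Ge in c1.
  have corr' : eta * (eps ^+ 2 * dJP) = - (eta * dt) * (moment V 2 M * r2 + RT + JP).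
    by rewrite corr; ring.
  clearbody A G Ge r2 E C D JJ dJP JP RT; lra.
have eta1 : eta * (A / m2lo) <= 2^-1 * (1 - eta * m2hi).
  rewrite mulrA ler_pdivrMr //; lra.
have eta2 : 0 <= 1 - eta * m2hi.
  apply: le_trans (_ : 0 <= 2 * (eta * (A / m2lo))) _; last by lra.
  by rewrite !mulr_ge0 ?invr_ge0 // ltW.
have K1 : K <= 2^-1 * (1 - eta * m2hi) by rewrite ler_pM2l ?invr_gt0 // ge_min lexx.
have K2 : K <= 2^-1 * (eta * m2lo) by rewrite ler_pM2l ?invr_gt0 // ge_min lexx orbT.
rewrite -/(fluctuation V M (f n.+2)) -/g sqg -/r2.
(* What remains is [(1 - eta * m2hi) / 2] times [Ge], hence times [G], and [eta * m2lo / 2] times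
   [r2]; [K] is the smaller of the two coefficients. *)
have k1 := ler_wpM2r G_ge0 K1; have k2 := ler_wpM2r r2_ge0 K2.
have k3 := ler_wpM2l eta2 G_le.
have k4 := ler_wpM2r (le_trans G_ge0 G_le) eta1.
have k5 : eta * (m2hi * G) <= eta * (m2hi * Ge).
  by rewrite !ler_pM2l.
lra.
Qed.
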